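(* Let $(X_n,\mathcal P_n)$ be a sequence of homogeneous unbounded tree-graded metric spaces with observation points $o_n\in X_n$. Let $\omega$ be an ultrafilter. Then the ultralimit $\lim^\omega(X_n,o_n)$ has a tree-graded structure with a non-trivial transversal tree at every point.
   Context: A metric space is homogeneous if its isometry group acts transitively on it. All ultrafilters are non-principal ultrafilters on $\mathbb N$. The ultralimit $\lim^\omega(X_n,o_n)$ is the quotient of the set of sequences $(x_n)$, $x_n\in X_n$, with $\lim_\omega\mathrm{dist}(x_n,o_n)<\infty$ by the relation $\lim_\omega\mathrm{dist}(x_n,y_n)=0$, with metric $\lim_\omega\mathrm{dist}(x_n,y_n)$. A complete geodesic metric space $F$ is tree-graded with respect to a collection $\mathcal P$ of closed geodesic subsets, called pieces, if (T1) every two different pieces have at most one point in common, and (T2) every simple non-trivial geodesic triangle in $F$ is contained in one piece. That $(X_n,\mathcal P_n)$ is tree-graded means that $X_n$ is tree-graded with respect to $\mathcal P_n$. The topological arcs starting at a given point $x\in F$ and intersecting each piece in at most one point compose a real tree called the transversal tree at $x$; it is non-trivial if it is not reduced to a single point.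
   Formalization: The formal theorem adds that no X_n is itself one of its pieces (the tree-graded structure is non-trivial); without this the claim fails, e.g. for X_n the Euclidean plane with the whole plane as its only piece. *)

(* Defs.v *)
From HB Require Import structures.
From mathcomp Require Import all_boot all_order all_algebra.
From mathcomp Require Import all_classical all_reals.
From mathcomp Require Import topology normedtype.

Set Implicit Arguments.
Unset Strict Implicit.
Unset Printing Implicit Defensive.

Import Order.TTheory GRing.Theory Num.Theory.
Import numFieldTopology.Exports numFieldNormedType.Exports.

Local Open Scope classical_set_scope.
Local Open Scope ring_scope.

Section MetricSpaces.
Context {R : realType} (T : metricType R).

Definition isometry (f : T -> T) :=
  bijective f /\ forall u v, mdist (f u) (f v) = mdist u v.

Definition homogeneous := forall x y : T, exists2 f, isometry f & f x = y.

Definition unbounded := forall M : R, exists x y : T, M < mdist x y.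

(* Not [completeType], which requires a distinguished point. *)
Definition complete_space :=
  forall F : set_system T, ProperFilter F -> cauchy F ->
    exists x : T, F --> x.

(* Unit-speed parametrization on [[a, b]]; the values of [c] outside the
   interval are irrelevant.  When [a = b] the geodesic is a point. *)
Definition geodesic_on (c : R -> T) (a b : R) :=
  {in `[a, b] &, forall s t, mdist (c s) (c t) = `|s - t|}.

Definition geodesic_subset (A : set T) :=
  forall x y, A x -> A y -> exists (c : R -> T) (l : R),
    [/\ 0 <= l, geodesic_on c 0 l, c 0 = x, c l = y & c @` `[0, l] `<=` A].

Definition geodesic_space := geodesic_subset setT.

(* A geodesic triangle is parametrized as a closed path on [[0, l]] which is
   the concatenation of three geodesics, with vertices [c 0 = c l], [c a] and
   [c b].  Sides may be degenerate; the triangle is reduced to a point exactly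
   when [l = 0]. *)
Definition geodesic_triangle (c : R -> T) (a b l : R) :=
  [/\ 0 <= a <= b, b <= l, c 0 = c l &
      [/\ geodesic_on c 0 a, geodesic_on c a b & geodesic_on c b l]].

Definition simple_loop (c : R -> T) (l : R) := {in `[0, l[ &, injective c}.

(* Every complete geodesic space is tree-graded with respect to [[set setT]];
   excluding this case has to be required separately. *)
Definition tree_graded (P : set (set T)) :=
  [/\ complete_space, geodesic_space,
      forall A, P A -> closed A /\ geodesic_subset A,
      forall A B, P A -> P B -> A <> B -> is_subset1 (A `&` B) &
      forall c a b l, geodesic_triangle c a b l -> simple_loop c l -> 0 < l ->
        exists2 A, P A & c @` `[0, l] `<=` A].

Definition topological_arc_from (x : T) (g : R -> T) :=
  [/\ {within `[0, 1], continuous g}, {in `[0, 1] &, injective g} & g 0 = x].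

(* The point [x] is added so that the tree is [[set x]] when there is no arc. *)
Definition transversal_tree (P : set (set T)) (x : T) : set T :=
  [set x] `|` \bigcup_(g in [set g : R -> T | topological_arc_from x g /\
      forall A, P A -> is_subset1 (g @` `[0, 1] `&` A)]) (g @` `[0, 1]).

Definition nontrivial_transversal_tree (P : set (set T)) (x : T) :=
  transversal_tree P x <> [set x].

End MetricSpaces.

Definition nonprincipal {I : Type} (w : set_system I) :=
  forall i : I, w <> principal_filter i.

Section Ultralimit.
Context {R : realType} (w : set_system nat) {wU : UltraFilter w}.

Lemma ultra_bounded_cvg (u : nat -> R) (M : R) :
  (\forall n \near w, 0 <= u n <= M) -> cvg (u n @[n --> w]).
Proof.
move=> uM; pose A := `[0, M]%classic : set R.
have FA : (u @ w) A by apply: filterS uM => n; rewrite /A /= in_itv.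
have [p [_ up]] := @segment_compact R 0 M (u @ w) _ FA.
suff : u @ w --> p by move/cvgP.
move=> B Bp; have [//|nB] := in_ultra_setVsetC (u @^-1` B) wU.
by have [z []] := up _ _ (nB : (u @ w) (~` B)) Bp.
Qed.

Lemma ultra_cvg_bounded (u : nat -> R) :
  cvg (u n @[n --> w]) -> exists M, \forall n \near w, u n <= M.
Proof.
move=> cu; exists (lim (u n @[n --> w]) + 1).
have l1 : lim (u n @[n --> w]) < lim (u n @[n --> w]) + 1 by rewrite ltrDl.
by apply: filterS (cvgr_lt _ cu _ l1) => n /ltW.
Qed.

Section Sequences.
Variables (X : nat -> metricType R) (o : forall n, X n).

(* Convergence is in [R], so this says that [lim_w dist(x_n, o_n)] is finite. *)
Definition admissible (x : forall n, X n) :=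
  `[< cvg (mdist (x n) (o n) @[n --> w]) >].

Definition admissible_seq := {x : forall n, X n | admissible x}.

Definition seq_dist (x y : admissible_seq) : R :=
  lim (mdist (sval x n) (sval y n) @[n --> w]).

Lemma seq_dist_cvg (x y : admissible_seq) :
  mdist (sval x n) (sval y n) @[n --> w] --> seq_dist x y.
Proof.
have [M xM] := ultra_cvg_bounded (asboolW (svalP x)).
have [N yN] := ultra_cvg_bounded (asboolW (svalP y)).
apply: (@ultra_bounded_cvg _ (M + N)).
apply: filterS2 xM yN => n xM yN; rewrite mdist_ge0 /=.
apply: le_trans (metric_triangle _ (o n) _) _.
by rewrite lerD// metric_sym.
Qed.

Lemma seq_distxx x : seq_dist x x = 0.
Proof.
apply: cvg_lim => //; under eq_fun do rewrite mdistxx.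
exact: cvg_cst.
Qed.

Lemma seq_dist_sym x y : seq_dist x y = seq_dist y x.
Proof. by rewrite /seq_dist; under eq_fun do rewrite metric_sym. Qed.

Lemma seq_dist_triangle y x z : seq_dist x z <= seq_dist x y + seq_dist y z.
Proof.
rewrite -subr_ge0.
apply: (cvgr_to_ge (cvgB (cvgD (@seq_dist_cvg x y) (@seq_dist_cvg y z))
  (@seq_dist_cvg x z))).
by apply: nearW => n /=; rewrite subr_ge0; exact: metric_triangle.
Qed.

Lemma seq_dist_ge0 x y : 0 <= seq_dist x y.
Proof.
rewrite -(@pmulrn_lge0 _ _ 2)// -(seq_distxx x).
by rewrite (le_trans (seq_dist_triangle y _ _))// seq_dist_sym -mulr2n.
Qed.

Definition ultra_equiv : rel admissible_seq := fun x y => seq_dist x y == 0.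

Lemma ultra_equiv_refl : reflexive ultra_equiv.
Proof. by move=> x; apply/eqP; exact: seq_distxx. Qed.

Lemma ultra_equiv_sym : symmetric ultra_equiv.
Proof. by move=> x y; rewrite /ultra_equiv seq_dist_sym. Qed.

Lemma ultra_equiv_trans : transitive ultra_equiv.
Proof.
move=> y x z /eqP xy /eqP yz; rewrite /ultra_equiv eq_le seq_dist_ge0 andbT.
by rewrite (le_trans (seq_dist_triangle y _ _))// xy yz addr0.
Qed.

Canonical ultra_equiv_rel :=
  EquivRel ultra_equiv ultra_equiv_refl ultra_equiv_sym ultra_equiv_trans.

Definition ultralimit := {eq_quot ultra_equiv_rel}%qT.

HB.instance Definition _ := Choice.on ultralimit.
HB.instance Definition _ := EqQuotient.on ultralimit.

Definition ultralimit_dist (x y : ultralimit) : R := seq_dist (repr x) (repr y).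

Lemma ultralimit_distE (x y : admissible_seq) :
  ultralimit_dist (\pi_ultralimit%qT x) (\pi_ultralimit%qT y) = seq_dist x y.
Proof.
have dr (z : admissible_seq) : seq_dist (repr (\pi_ultralimit%qT z)) z = 0.
  have : (repr (\pi_ultralimit%qT z) = z %[mod ultralimit])%qT by rewrite reprK.
  by move/eqmodP/eqP.
have le (a b c d : admissible_seq) :
    seq_dist a c = 0 -> seq_dist b d = 0 -> seq_dist a b <= seq_dist c d.
  move=> ac bd; apply: le_trans (seq_dist_triangle c _ _) _.
  rewrite ac add0r; apply: le_trans (seq_dist_triangle d _ _) _.
  by rewrite (seq_dist_sym d) bd addr0.
by apply/eqP; rewrite eq_le !le// seq_dist_sym.
Qed.

Lemma ultralimit_distxx x : ultralimit_dist x x = 0.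
Proof. exact: seq_distxx. Qed.

Lemma ultralimit_dist_eq0 x y : ultralimit_dist x y = 0 -> x = y.
Proof. by move=> /eqP xy; rewrite -(reprK x) -(reprK y); apply/eqmodP. Qed.

Lemma ultralimit_dist_sym x y : ultralimit_dist x y = ultralimit_dist y x.
Proof. exact: seq_dist_sym. Qed.

Lemma ultralimit_dist_triangle y x z :
  ultralimit_dist x z <= ultralimit_dist x y + ultralimit_dist y z.
Proof. exact: seq_dist_triangle. Qed.

HB.instance Definition _ := isMetric.Build R ultralimit ultralimit_distxx
  ultralimit_dist_eq0 ultralimit_dist_sym ultralimit_dist_triangle.

End Sequences.
End Ultralimit.

Arguments ultralimit {R} w {wU} X o.

(* Main.v *)
(* In any complete geodesic space, call two points inseparable when no third
   point separates them, and let the blocks be the maximal sets of pairwise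
   inseparable points.  Any two points of a simple loop are inseparable, so the
   blocks form a tree-graded structure; in particular this applies to the
   ultralimit.

   A piece of X_n with at least two points is a proper subset, and the gate on
   it of an outside point is a cut point.  By homogeneity every point of X_n is
   a cut point, so one can walk away from any point with steps of length
   e_n <= 1/(n+1), crossing to another side of the current point at each step.
   The walk is isometric to a subset of e_n N and each of its points separates
   the earlier ones from the later ones.  The limit of these walks is a geodesic
   ray, each point of which separates the points before it from those after it:
   it meets every block at most once, so it is a transversal arc. *)

Require Import Defs.
From mathcomp Require Import all_boot all_order all_algebra.
From mathcomp Require Import all_classical all_reals.
From mathcomp Require Import topology normedtype.
From mathcomp Require Import lra.

Set Implicit Arguments.
Unset Strict Implicit.
Unset Printing Implicit Defensive.

Import Order.TTheory GRing.Theory Num.Theory.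
Import numFieldTopology.Exports numFieldNormedType.Exports.

Local Open Scope classical_set_scope.
Local Open Scope ring_scope.

(** * Cut points, inseparability, and the tree-graded structure formed by the blocks *)

Section Separation.
Context {R : realType} (T : metricType R).
Implicit Types (v x y z : T) (U : set T) (c : R -> T).

(* [v] separates [U] from its complement, in a form that passes to ultralimits
   without mentioning paths.  Whether [v] itself lies in [U] is irrelevant. *)
Definition cut_set v U :=
  forall a b, U a -> ~ U b -> mdist a b = mdist a v + mdist v b.

Definition separates v x y :=
  exists U, [/\ cut_set v U, U x, ~ U y & v <> x /\ v <> y].

Definition inseparable x y := forall v, ~ separates v x y.

(** Two distinct inseparable points determine one maximal set of pairwise inseparable points; they
    serve as coordinates for it, and by [block_eq] any two distinct members give the same set. *)
Definition block x y : set T := [set z | inseparable x z /\ inseparable y z].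

Definition blocks : set (set T) :=
  [set A | exists x y, [/\ x <> y, inseparable x y & A = block x y]].

Lemma mdist_gt0P x y : x <> y -> 0 < mdist x y.
Proof. by move/eqP; rewrite mdist_gt0. Qed.

Lemma cut_setC v U : cut_set v U -> cut_set v (~` U).
Proof.
move=> vU a b na /contrapT Ub.
by rewrite metric_sym (vU b a Ub na) addrC (metric_sym b) (metric_sym a).
Qed.

Lemma separates_sym v x y : separates v x y -> separates v y x.
Proof.
move=> [U [vU Ux nUy [vx vy]]]; exists (~` U); split => //.
exact: cut_setC.
Qed.

Lemma inseparable_sym x y : inseparable x y -> inseparable y x.
Proof. by move=> xy v /separates_sym; exact: xy. Qed.

Lemma inseparable_cut v x y U : inseparable x y -> cut_set v U ->
  v <> x -> v <> y -> U x -> U y.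
Proof. by move=> xy vU vx vy Ux; apply: contrapT => nUy; apply: (xy v); exists U. Qed.

Lemma cut_set_near v U a b : cut_set v U -> mdist a b < mdist a v -> U a -> U b.
Proof.
move=> vU ab Ua; apply: contrapT => /(vU _ _ Ua) e.
by have := mdist_ge0 v b; lra.
Qed.

Lemma geodesic_on_sub c (a b s t : R) : a <= s -> t <= b ->
  geodesic_on c a b -> geodesic_on c s t.
Proof.
move=> as_ tb cg p q; rewrite !in_itv/= => /andP[sp pt] /andP[sq qt].
by apply: cg; rewrite in_itv/=; apply/andP; split; lra.
Qed.

Lemma geodesic_onE c (a b s t : R) : geodesic_on c a b -> a <= s -> s <= t ->
  t <= b -> mdist (c s) (c t) = t - s.
Proof.
move=> cg as_ st tb; rewrite cg ?in_itv/=; [|apply/andP; split; lra..].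
by rewrite distrC ger0_norm// subr_ge0.
Qed.

(** The point of [c] at distance [mdist (c s) v] from [c s] must be [v]: whichever side it lies on,
    the cut equality with the endpoint on the other side leaves it at distance 0 from [v]. *)
Lemma geodesic_cut v U c (s t : R) : cut_set v U -> geodesic_on c s t ->
  s <= t -> U (c s) -> ~ U (c t) -> exists2 r, s <= r <= t & c r = v.
Proof.
move=> vU cg st Us nUt; have e := vU _ _ Us nUt.
have E := geodesic_onE cg (lexx _) st (lexx _).
have v0 := mdist_ge0 (c s) v; have v1 := mdist_ge0 v (c t).
exists (s + mdist (c s) v); first by apply/andP; split; lra.
set m := s + _; have e1 := geodesic_onE cg (lexx _) (_ : s <= m) (_ : m <= t).
have e2 := geodesic_onE cg (_ : s <= m) (_ : m <= t) (lexx _).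
have {}e1 : mdist (c s) (c m) = mdist (c s) v by rewrite e1 /m; lra.
have {}e2 : mdist (c m) (c t) = mdist v (c t) by rewrite e2 /m; lra.
apply: mdist_positivity; have [Um|nUm] := pselect (U (c m)).
- by have := vU _ _ Um nUt; lra.
- by have := vU _ _ Us nUm; rewrite (metric_sym (c m)); lra.
Qed.

(** A separating point differs from [x] or from [y], and whichever of the two it misses ties [z] and
    [z'] to the same side. *)
Lemma block_inseparable x y z z' : x <> y ->
  block x y z -> block x y z' -> inseparable z z'.
Proof.
move=> xy [xz yz] [xz' yz'] v [U [vU Uz nUz' [vz vz']]].
have [vx|vx] := pselect (v = x).
- have vy : v <> y by rewrite vx.
  by apply: nUz'; apply: (inseparable_cut yz' vU) => //;
    apply: (inseparable_cut (inseparable_sym yz) vU).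
- by apply: nUz'; apply: (inseparable_cut xz' vU) => //;
    apply: (inseparable_cut (inseparable_sym xz) vU).
Qed.

Lemma block_eq x y p q : x <> y -> inseparable x y -> p <> q ->
  block x y p -> block x y q -> block x y = block p q.
Proof.
move=> nxy xy npq bp bq; apply/seteqP; split => z.
  by move=> bz; split; exact: block_inseparable bz.
have bx : block p q x by split; apply: inseparable_sym; [case: bp|case: bq].
have by_ : block p q y by split; apply: inseparable_sym; [case: bp|case: bq].
by move=> bz; split; exact: block_inseparable bz.
Qed.

(** A point [v] separating [x] from [z] still separates [x] from every point closer to [z] than [v]
    is. *)
Lemma inseparable_closed x : closed (inseparable x).
Proof.
move=> z clz v [U [vU Ux nUz [vx vz]]].
have vz0 : 0 < mdist z v by rewrite metric_sym mdist_gt0P.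
have [w [xw]] := clz _ (nbhsx_ballx z _ vz0).
rewrite ballEmdist/= => zw; apply: (xw v); exists U; split => //.
  exact: (cut_set_near (cut_setC vU) zw nUz).
by split=> // vw; move: zw; rewrite vw ltxx.
Qed.

(** If [v] separated [c r] from [x], then [p] and [q] would each equal [v] or lie on the side of
    [x]. The distances from [c r] to both would add up through [v], so going from [p] to [q] via [v]
    would be shorter than along [c]. *)
Lemma geodesic_inseparable p q x c (l r : R) : inseparable p x ->
  inseparable q x -> geodesic_on c 0 l -> c 0 = p -> c l = q -> 0 <= r <= l ->
  inseparable (c r) x.
Proof.
move=> px qx cg c0 cl /andP[r0 rl] v [U [vU Uz nUx [vz vx]]].
have dpz := geodesic_onE cg (lexx _) r0 rl.
have dzq := geodesic_onE cg r0 rl (lexx _).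
have dpq := geodesic_onE cg (lexx _) (le_trans r0 rl) (lexx _).
have far w : inseparable w x ->
    mdist (c r) w = mdist (c r) v + mdist v w.
  move=> wx; have [->|vw] := pselect (v = w); first by rewrite mdistxx addr0.
  by apply: (vU) => // Uw; apply: nUx; exact: (inseparable_cut wx vU).
have := far _ px; have := far _ qx.
have := metric_triangle p v q; have := mdist_gt0P vz.
move: dpz dzq dpq; rewrite c0 cl (metric_sym p (c r)) (metric_sym v (c r)).
by rewrite (metric_sym p v); lra.
Qed.

(** Both arcs of the loop between the two points would have to pass through a separating point,
    which a simple loop visits only once. *)
Lemma triangle_inseparable c (a b l s t : R) : geodesic_triangle c a b l ->
  simple_loop c l -> 0 <= s <= l -> 0 <= t <= l -> inseparable (c s) (c t).
Proof.
move=> [/andP[a0 ab] bl c0l [ca cab cbl]] cs.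
wlog st : s t / s <= t.
  move=> H s0 t0; have [st|ts] := leP s t; first exact: H.
  by apply: inseparable_sym; apply: H => //; exact: ltW.
move=> /andP[s0 sl] /andP[t0 tl] v [U [vU Us nUt [vs vt]]].
(* A stretch of [c] that avoids [v] cannot leave [W]. This is obtained on each side by
   [geodesic_cut] and then glued at the vertices. *)
pose K (W : set T) p q := forall s t, p <= s -> s <= t -> t <= q ->
  (forall r, s <= r <= t -> c r <> v) -> W (c s) -> W (c t).
have K0l W : cut_set v W -> K W 0 l.
  move=> vW.
  have Kg p q : geodesic_on c p q -> K W p q.
    move=> pq s' t' ps s't tq nv Ws; apply: contrapT => nWt.
    have [r rst /nv] := geodesic_cut vW (geodesic_on_sub ps tq pq) s't Ws nWt.
    exact.
  have Kc p q r : K W p q -> K W q r -> K W p r.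
    move=> pq qr s' t' ps s't tr nv Ws.
    have [tq|qt] := leP t' q; first exact: pq nv Ws.
    have [qs|sq] := leP q s'; first exact: qr nv Ws.
    apply: (qr q) => //; [exact: ltW| |].
      by move=> u ?; apply: nv; lra.
    apply: (pq s') => //; [exact: ltW|].
    by move=> u ?; apply: nv; lra.
  by apply: (Kc _ b); [apply: (Kc _ a)|]; exact: Kg.
have [r rst crv] : exists2 r, s <= r <= t & c r = v.
  apply: contrapT => nr; apply: nUt; apply: (K0l _ vU s t) => // r rst crv.
  by apply: nr; exists r.
have sr : s < r.
  by rewrite lt_neqAle; apply/andP; split; [apply/eqP => srE; apply: vs; rewrite srE|lra].
have rt : r < t.
  by rewrite lt_neqAle; apply/andP; split; [apply/eqP => rtE; apply: vt; rewrite -rtE|lra].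
have inj u : 0 <= u -> u < l -> c u = v -> u = r.
  by move=> u0 ul cu; apply: cs; rewrite ?in_itv/= ?crv//; lra.
(* The other arc runs from [t] to [l], resumes at time 0 and reaches [s]; it avoids [v], which is
   visited only at time [r]. *)
apply: (K0l _ (cut_setC vU) 0 s) => // [u|].
  by move=> /andP[u0 us] /(inj _ u0); lra.
rewrite c0l; apply: (K0l _ (cut_setC vU) t l) => // u /andP[tu ul] cu.
(* Injectivity holds on [[0, l[] only, so a visit at time [l] is moved to time 0. *)
have [ul'|lu] := ltP u l; first by have := inj u ltac:(lra) ul' cu; lra.
have ul' : u = l by lra.
by have := inj 0 (lexx _) ltac:(lra); rewrite c0l -ul' => /(_ cu); lra.
Qed.

Lemma blocks_tree_graded : complete_space T -> geodesic_space T ->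
  tree_graded blocks.
Proof.
move=> cT gT; split => //.
- move=> _ [x [y [nxy xy ->]]]; split.
    by apply: (@closedI _ (inseparable x) (inseparable y)); exact: inseparable_closed.
  move=> p q [xp yp] [xq yq]; have [c [l [l0 cg c0 cl _]]] := gT p q I I.
  exists c, l; split => // _ [r /= + <-]; rewrite in_itv/= => r0l.
  by split; apply: inseparable_sym; apply: (geodesic_inseparable _ _ cg c0 cl r0l);
    exact: inseparable_sym.
- move=> _ _ [x [y [nxy xy ->]]] [x' [y' [nxy' xy' ->]]] nAB p q [Ap Bp] [Aq Bq].
  apply: contrapT => npq; apply: nAB.
  by rewrite (block_eq nxy xy npq Ap Aq) (block_eq nxy' xy' npq Bp Bq).
- move=> c a b l ct cs l0.
  have l2 : 0 <= l / 2 <= l by lra.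
  have h r s : 0 <= r <= l -> 0 <= s <= l -> inseparable (c r) (c s).
    exact: triangle_inseparable ct cs.
  exists (block (c 0) (c (l / 2))).
    exists (c 0), (c (l / 2)); split => //; last by apply: h; lra.
    have /cs : 0 \in `[0, l[ by rewrite in_itv/= lexx.
    by move=> /(_ (l / 2)); rewrite in_itv/= => H /H -/(_ ltac:(lra)); lra.
  by move=> _ [r /= + <-]; rewrite in_itv/= => r0l; split; apply: h => //; lra.
Qed.

End Separation.

(** * Projections onto pieces, and the existence of cut points *)

Section Gates.
Context {R : realType} (T : metricType R).
Implicit Types (p q x y z : T) (A : set T) (c f g h : R -> T).

Lemma geodesic_on_inj c (a b s t : R) : geodesic_on c a b ->
  a <= s <= b -> a <= t <= b -> c s = c t -> s = t.
Proof.
move=> cg sab tab cst; have := cg s t; rewrite !in_itv/= sab tab cst mdistxx.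
by move=> /(_ isT isT)/esym/normr0_eq0; lra.
Qed.

Lemma geodesic_on_opp c (a b : R) : geodesic_on c a b ->
  geodesic_on (fun t => c (- t)) (- b) (- a).
Proof.
move=> cg s t; rewrite !in_itv/= => sab tab.
rewrite cg ?in_itv/=; [|lra..].
by rewrite -opprB opprK addrC normrN.
Qed.

Lemma geodesic_on_continuous c (a b : R) : geodesic_on c a b ->
  {within `[a, b], continuous c}.
Proof.
move=> cg; apply/subspace_continuousP => r /= rab.
apply/metricType_numDomainType.fcvgrPdist_lt => e e0.
by apply: filterS (nbhsx_ballx r e e0) => s /= rs sab; rewrite cg.
Qed.

Lemma geodesic_image_closed c (a b : R) : geodesic_on c a b ->
  closed (c @` `[a, b]).
Proof.
move=> cg; apply: compact_closed; first exact: metric_hausdorff.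
apply: continuous_compact; first exact: geodesic_on_continuous.
exact: segment_compact.
Qed.

Lemma geodesic_first_hit A c (a b t : R) : closed A -> geodesic_on c a b ->
  a <= t <= b -> A (c t) ->
  exists r, [/\ a <= r <= b, A (c r) & forall s, a <= s < r -> ~ A (c s)].
Proof.
move=> clA cg tab At.
pose S : set R := [set s | a <= s <= b /\ A (c s)].
have St : S t by [].
have infS : has_inf S by split; [exists t|exists a => s [/andP[]]].
have ai : a <= inf S by apply: lb_le_inf; [exists t|move=> s [/andP[]]].
have it : inf S <= t by apply: ge_inf => //; exists a => s [/andP[]].
have iab : a <= inf S <= b by lra.
exists (inf S); split => //; last first.
  move=> s /andP[as_ si] As; have : inf S <= s.
    by apply: ge_inf; [exists a => u [/andP[]]|split => //; lra].
  by lra.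
apply: clA => W /metricType_numDomainType.nbhs_mdistP[e /= e0 eW].
have [s Ss sie] := inf_adherent e0 infS.
have is_ : inf S <= s by apply: ge_inf => //; exists a => u [/andP[]].
exists (c s); split; first by have [] := Ss.
apply: eW => /=; rewrite (geodesic_onE cg _ is_) //; last by have [] := Ss; lra.
by lra.
Qed.

Lemma geodesic_last_hit A c (a b t : R) : closed A -> geodesic_on c a b ->
  a <= t <= b -> A (c t) ->
  exists r, [/\ a <= r <= b, A (c r) & forall s, r < s <= b -> ~ A (c s)].
Proof.
move=> clA cg tab At.
have [||r [rab Ar nA]] := geodesic_first_hit (t := - t) clA (geodesic_on_opp cg).
- by lra.
- by rewrite opprK.
exists (- r); split => //; first by lra.
by move=> s rs; rewrite -(opprK s); apply: nA; lra.
Qed.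

(** Turns three sides meeting only at common vertices into one simple loop. The later uses need the
    side [g], which will carry two points of a piece, and the opposite vertex [f a1], which will
    then be forced into the piece. *)
Lemma triangle_concat f g h (a1 b1 a2 b2 a3 b3 : R) :
  geodesic_on f a1 b1 -> geodesic_on g a2 b2 -> geodesic_on h a3 b3 ->
  a1 <= b1 -> a2 <= b2 -> a3 <= b3 ->
  f b1 = g a2 -> g b2 = h a3 -> h b3 = f a1 ->
  (forall s t, a1 <= s <= b1 -> a2 <= t <= b2 -> f s = g t -> s = b1 /\ t = a2) ->
  (forall s t, a2 <= s <= b2 -> a3 <= t <= b3 -> g s = h t -> s = b2 /\ t = a3) ->
  (forall s t, a1 <= s <= b1 -> a3 <= t <= b3 -> f s = h t -> s = a1 /\ t = b3) ->
  exists c (a b l : R), [/\ geodesic_triangle c a b l, simple_loop c l,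
    b2 - a2 <= l, c 0 = f a1 &
    forall t, a2 <= t <= b2 -> (c @` `[0, l]) (g t)].
Proof.
move=> fg gg hg ab1 ab2 ab3 fg1 gh2 hf3 H12 H23 H13.
pose l1 := b1 - a1; pose l2 := b2 - a2; pose l3 := b3 - a3.
pose c t := if t <= l1 then f (a1 + t) else
  if t <= l1 + l2 then g (a2 + (t - l1)) else h (a3 + (t - l1 - l2)).
have c1 t : t <= l1 -> c t = f (a1 + t) by rewrite /c => ->.
have c2 t : l1 <= t <= l1 + l2 -> c t = g (a2 + (t - l1)).
  move=> /andP[lt tl]; rewrite /c tl; case: leP => // tl1.
  have -> : t = l1 by lra.
  by rewrite subrr addr0 -fg1 /l1 addrC subrK.
have c3 t : l1 + l2 <= t -> c t = h (a3 + (t - l1 - l2)).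
  move=> lt; have [tl|lt'] := leP t (l1 + l2); last first.
    by rewrite /c !leNgt lt'/= (_ : l1 < t)//; rewrite /l2 in lt' *; lra.
  have -> : t = l1 + l2 by lra.
  rewrite c2; last by rewrite /l2; lra.
  have -> : a2 + (l1 + l2 - l1) = b2 by rewrite /l2; lra.
  by rewrite gh2; congr h; lra.
have tr (k : R -> T) (d a b s t : R) : geodesic_on k a b -> a <= d + s <= b -> a <= d + t <= b ->
    mdist (k (d + s)) (k (d + t)) = `|s - t|.
  move=> kg sab tab; rewrite kg ?in_itv//=.
  by congr (`|_|); lra.
exists c, l1, (l1 + l2), (l1 + l2 + l3).
have l1P : l1 = b1 - a1 by []. have l2P : l2 = b2 - a2 by [].
have l3P : l3 = b3 - a3 by [].
split.
- split; [lra|lra| |].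
    rewrite c1 ?c3; [|lra|lra].
    by rewrite addr0 -hf3; congr h; lra.
  split => s t; rewrite !in_itv/= => sl tl.
  + by rewrite !c1; [rewrite (tr _ _ _ _ _ _ fg)//|..]; lra.
  + rewrite !c2//; have := tr _ (a2 - l1) _ _ s t gg.
    have -> : a2 - l1 + s = a2 + (s - l1) by lra.
    have -> : a2 - l1 + t = a2 + (t - l1) by lra.
    by apply; lra.
  + rewrite !c3; [|lra|lra]; have := tr _ (a3 - l1 - l2) _ _ s t hg.
    have -> : a3 - l1 - l2 + s = a3 + (s - l1 - l2) by lra.
    have -> : a3 - l1 - l2 + t = a3 + (t - l1 - l2) by lra.
    by apply; lra.
- move=> s t; rewrite !in_itv/= => sl tl.
  wlog st : s t sl tl / s <= t.
    move=> H; have [st|ts] := leP s t; first exact: H.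
    by move=> /esym e; apply/esym; apply: H e => //; exact: ltW.
  have [tl1|lt1] := leP t l1.
    rewrite !c1; [|lra|lra] => e.
    by have := geodesic_on_inj fg _ _ e; lra.
  have [tl2|lt2] := leP t (l1 + l2).
    rewrite (c2 t); last by lra.
    have [sl1|ls1] := leP s l1.
      rewrite c1// => e.
      by have := H12 _ _ _ _ e; lra.
    rewrite c2; last by lra.
    by move=> e; have := geodesic_on_inj gg _ _ e; lra.
  rewrite (c3 t); last by lra.
  have [sl1|ls1] := leP s l1.
    rewrite c1// => e.
    by have := H13 _ _ _ _ e; lra.
  have [sl2|ls2] := leP s (l1 + l2).
    rewrite c2; last by lra.
    by move=> e; have := H23 _ _ _ _ e; lra.
  rewrite c3; last by lra.
  by move=> e; have := geodesic_on_inj hg _ _ e; lra.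
- by lra.
- by rewrite c1 ?addr0//; lra.
- move=> t tab; exists (l1 + (t - a2)); first by rewrite /= in_itv/=; lra.
  by rewrite c2; [congr g; lra|lra].
Qed.

Section Gate.
Variable A : set T.
Hypothesis gT : geodesic_space T.
Hypothesis clA : closed A.
Hypothesis gA : geodesic_subset A.
(** For a piece this follows from (T2) and (T1): the piece containing the triangle shares two points
    with [A]. Stated this way, it also covers a geodesic segment in a space without simple
    triangles. *)
Hypothesis triA : forall c (a b l : R) p q, geodesic_triangle c a b l ->
  simple_loop c l -> 0 < l -> A p -> A q -> p <> q ->
  (c @` `[0, l]) p -> (c @` `[0, l]) q -> c @` `[0, l] `<=` A.

Lemma triangle_in_piece f g h (a1 b1 a2 b2 a3 b3 s t : R) :
  geodesic_on f a1 b1 -> geodesic_on g a2 b2 -> geodesic_on h a3 b3 ->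
  a1 <= b1 -> a2 <= b2 -> a3 <= b3 ->
  f b1 = g a2 -> g b2 = h a3 -> h b3 = f a1 ->
  (forall s t, a1 <= s <= b1 -> a2 <= t <= b2 -> f s = g t -> s = b1 /\ t = a2) ->
  (forall s t, a2 <= s <= b2 -> a3 <= t <= b3 -> g s = h t -> s = b2 /\ t = a3) ->
  (forall s t, a1 <= s <= b1 -> a3 <= t <= b3 -> f s = h t -> s = a1 /\ t = b3) ->
  a2 <= s <= b2 -> a2 <= t <= b2 -> g s <> g t -> A (g s) -> A (g t) -> A (f a1).
Proof.
move=> fg gg hg ab1 ab2 ab3 e1 e2 e3 H12 H23 H13 s2 t2 gst As At.
have [c [a [b [l [ct cs l2 c0 cg]]]]] :=
  triangle_concat fg gg hg ab1 ab2 ab3 e1 e2 e3 H12 H23 H13.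
have st : s <> t by move=> st; apply: gst; rewrite st.
have l0 : 0 < l by lra.
rewrite -c0; apply: (triA ct cs l0 As At gst (cg _ s2) (cg _ t2)).
by exists 0 => //=; rewrite in_itv/= lexx ltW.
Qed.

(** If the entry points differed, the two geodesics after their last common point and a geodesic of
    [A] joining the entry points would bound a simple triangle. Having two points in [A], it would
    lie in [A], and so would the common point, which precedes the first entry. *)
Lemma first_hit_uniq c1 c2 (r1 r2 : R) : geodesic_on c1 0 r1 ->
  geodesic_on c2 0 r2 -> 0 <= r1 -> 0 <= r2 -> c1 0 = c2 0 ->
  A (c1 r1) -> A (c2 r2) ->
  (forall s, 0 <= s < r1 -> ~ A (c1 s)) ->
  (forall s, 0 <= s < r2 -> ~ A (c2 s)) -> c1 r1 = c2 r2.
Proof.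
move=> g1 g2 r10 r20 c12 A1 A2 n1 n2; apply: contrapT => n12.
have hit0 : (c2 @` `[0, r2]) (c1 0).
  by exists 0; rewrite /= ?in_itv/= ?lexx.
have [|s [sr [s' /=]]] :=
    geodesic_last_hit (geodesic_image_closed g2) g1 _ hit0.
  by lra.
rewrite in_itv/= => s'r e nB.
(* Both times equal the distance to the common starting point. *)
have s's : s' = s.
  have [s0 s1] := andP sr; have [s'0 s'1] := andP s'r.
  have d1 := geodesic_onE g1 (lexx _) s0 s1.
  have d2 := geodesic_onE g2 (lexx _) s'0 s'1.
  by move: d2; rewrite -c12 e d1; lra.
rewrite {}s's in s'r e.
have sr1 : s < r1.
  rewrite lt_neqAle; apply/andP; split; last by lra.
  apply/eqP => sE; apply: n12; rewrite sE in e s'r; rewrite -e; congr c2.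
  have [lt|le] := ltP r1 r2; last by lra.
  by case: (n2 r1); [lra|rewrite e].
have sr2 : s < r2.
  rewrite lt_neqAle; apply/andP; split; last by lra.
  apply/eqP => sE; apply: n12; rewrite sE in e sr sr1 *.
  by case: (n1 r2); [lra|rewrite -e].
have [g [l [l0 gg gp1 gp2 gsub]]] := gA A1 A2.
apply: (n1 s); first by lra.
apply: (triangle_in_piece (f := c1) (b1 := r1) (g := g) (a2 := 0) (b2 := l)
  (h := fun t => c2 (- t)) (a3 := - r2) (b3 := - s) (s := 0) (t := l)) => //.
- by apply: geodesic_on_sub g1 => //; lra.
- by apply: geodesic_on_opp; apply: geodesic_on_sub g2 => //; lra.
- by lra.
- by lra.
- by rewrite opprK.
- by rewrite opprK.
- move=> u t us tl eu; have uE : u = r1.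
    have [ur|ru] := ltP u r1; last by lra.
    case: (n1 u); first by lra.
    by rewrite eu; apply: gsub; exists t.
  split=> //; apply: (geodesic_on_inj gg) => //; first by rewrite lexx.
  by rewrite -eu uE.
- move=> u t ul ts eu.
  have tE : t = - r2.
    have [tr|rt] := leP t (- r2); first by lra.
    case: (n2 (- t)); first by lra.
    by rewrite -eu; apply: gsub; exists u.
  split=> //; apply: (geodesic_on_inj gg) => //; first by rewrite lexx l0.
  by rewrite eu tE opprK.
- move=> u t us ts eu.
  have uE : u = s.
    have [uls|su] := leP u s; first by lra.
    case: (nB u); first by lra.
    by exists (- t); rewrite ?in_itv/=//; lra.
  split=> //; apply: oppr_inj; rewrite opprK.
  apply: (geodesic_on_inj g2); [lra|lra|].
  by rewrite -eu uE e.
- by rewrite lexx.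
- by rewrite lexx l0.
- by rewrite gp1 gp2.
- by rewrite gp1.
- by rewrite gp2.
Qed.

(* [p] is the projection of [x] on [A]. *)
Definition gate x p := A p /\ forall a, A a -> mdist x a = mdist x p + mdist p a.

Lemma gate_uniq x p q : gate x p -> gate x q -> p = q.
Proof.
move=> [Ap xp] [Aq xq]; apply: mdist_positivity.
have := xp _ Aq; have := xq _ Ap; rewrite (metric_sym q p).
by have := mdist_ge0 p q; lra.
Qed.

Lemma geodesic_between x y : exists c, [/\ geodesic_on c 0 (mdist x y), c 0 = x
  & c (mdist x y) = y].
Proof.
have [c [l [l0 cg cx cy _]]] := @gT x y I I.
have := geodesic_onE cg (lexx _) l0 (lexx _); rewrite cx cy subr0 => lE.
by exists c; rewrite lE.
Qed.

(** All geodesics from [x] to points of [A] enter [A] at the same point, by [first_hit_uniq]. *)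
Lemma gate_ex x : A !=set0 -> exists p, gate x p.
Proof.
move=> [a0 Aa0].
have hit a : A a -> exists c r, [/\ geodesic_on c 0 (mdist x a), c 0 = x,
    c (mdist x a) = a, 0 <= r <= mdist x a &
    A (c r) /\ forall s, 0 <= s < r -> ~ A (c s)].
  move=> Aa; have [c [cg c0 ca]] := geodesic_between x a.
  have [||r [ra Ar nA]] := geodesic_first_hit (t := mdist x a) clA cg.
  - by rewrite mdist_ge0 lexx.
  - by rewrite ca.
  by exists c, r.
have [c1 [r1 [g1 c10 c1a r1a [A1 n1]]]] := hit _ Aa0.
exists (c1 r1); split => // a /hit [c2 [r2 [g2 c20 c2a r2a [A2 n2]]]].
have -> : c1 r1 = c2 r2.
  apply: (first_hit_uniq (r1 := r1) (r2 := r2)) => //.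
  - by apply: geodesic_on_sub g1; lra.
  - by apply: geodesic_on_sub g2; lra.
  - by lra.
  - by lra.
  - by rewrite c10.
have [r20 r2l] := andP r2a.
have := geodesic_onE g2 (lexx _) r20 r2l; have := geodesic_onE g2 r20 r2l (lexx _).
by rewrite c20 c2a => -> ->; lra.
Qed.

Lemma gate_between x y p : gate x p -> mdist x p = mdist x y + mdist y p ->
  gate y p.
Proof.
move=> [Ap xp] xyp; split => // a Aa; have := xp a Aa.
have := metric_triangle x y a; have := metric_triangle y p a; lra.
Qed.

(** [A] is only assumed to contain some geodesic between its points. Here the gate of [c t] lies
    between [c t] and both endpoints, so additivity along [c] puts it at distance 0 from [c t]. *)
Lemma gate_convex c (l t : R) : geodesic_on c 0 l -> A (c 0) -> A (c l) ->
  0 <= t <= l -> A (c t).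
Proof.
move=> cg A0 Al tl; have [t0 tl'] := andP tl.
have [|p [Ap tp]] := gate_ex (c t); first by exists (c 0).
suff -> : c t = p by [].
apply: mdist_positivity.
have := tp _ A0; have := tp _ Al; have := metric_triangle (c 0) p (c l).
rewrite (geodesic_onE cg (lexx _) (le_trans t0 tl') (lexx _)).
rewrite (metric_sym (c t) (c 0)) (geodesic_onE cg (lexx _) t0 tl').
rewrite (geodesic_onE cg t0 tl' (lexx _)) (metric_sym p (c 0)).
by have := mdist_ge0 (c t) p; lra.
Qed.

Lemma gate_geodesic_disjoint x p c (u : R) : gate x p ->
  geodesic_on c 0 (mdist x p) -> c 0 = x -> 0 <= u < mdist x p -> ~ A (c u).
Proof.
move=> [_ xp] cg c0 /andP[u0 up] /xp.
have := geodesic_onE cg (lexx _) u0 (ltW up); rewrite c0 => ->.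
by have := mdist_ge0 p (c u); lra.
Qed.

Lemma gate_geodesic x p c (u : R) : gate x p ->
  geodesic_on c 0 (mdist x p) -> c 0 = x -> c (mdist x p) = p ->
  0 <= u <= mdist x p -> gate (c u) p.
Proof.
move=> xp cg c0 cp /andP[u0 up]; apply: gate_between xp _.
have := geodesic_onE cg (lexx _) u0 up; have := geodesic_onE cg u0 up (lexx _).
by rewrite c0 cp => -> ->; lra.
Qed.

(* If p <> q, the geodesics from c 0 to p and from c l to p (the latter passes
   through q) bound, with a part of c, a simple triangle having p and q in A. *)
Lemma gate_avoiding c (l : R) p q : geodesic_on c 0 l -> 0 <= l ->
  (forall t, 0 <= t <= l -> ~ A (c t)) -> gate (c 0) p -> gate (c l) q -> p = q.
Proof.
move=> cg l0 nA xp yq; apply: contrapT => npq.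
have [Ap _] := xp; have [Aq yqd] := yq.
have [h [hg h0 hp]] := geodesic_between (c 0) p.
set r := mdist (c 0) p in hg hp; have r0 : 0 <= r := mdist_ge0 _ _.
have [k [kg k0 kp]] := geodesic_between (c l) p.
set r' := mdist (c l) p in kg kp.
have [j [jg j0 jq]] := geodesic_between (c l) q.
set rho := mdist (c l) q in jg jq; have rho0 : 0 <= rho := mdist_ge0 _ _.
have r'E : r' = rho + mdist q p := yqd _ Ap.
have rr' : rho < r' by rewrite r'E ltrDl mdist_gt0P//; exact: nesym.
(* [k] enters [A] at the same point as [j], by [first_hit_uniq]. *)
have kq : k rho = q.
  have [||u [ur' Au nu]] := geodesic_first_hit (t := r') clA kg.
  - by lra.
  - by rewrite kp.
  have ku : k u = q.
    rewrite -jq; apply: (first_hit_uniq (r1 := u) (r2 := rho)) => //.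
    + by apply: geodesic_on_sub kg; lra.
    + by lra.
    + by rewrite k0 j0.
    + by rewrite jq.
    + by move=> s; exact: gate_geodesic_disjoint yq jg j0.
  have [u0 u1] := andP ur'.
  have := geodesic_onE kg (lexx _) u0 u1; rewrite k0 ku subr0 -/rho => ->.
  exact: ku.
have kA u : rho <= u <= r' -> A (k u).
  move=> ur; have := @gate_convex (fun t => k (rho + t)) (r' - rho) (u - rho).
  rewrite /= addr0 kq (_ : rho + (r' - rho) = r') ?kp; last by lra.
  rewrite (_ : rho + (u - rho) = u); last by lra.
  apply => //; last by lra.
  move=> s t; rewrite !in_itv/= => sr tr.
  rewrite kg ?in_itv/=; [|lra|lra].
  by congr (`|_|); lra.
have kgrho : geodesic_on k 0 rho by apply: geodesic_on_sub kg => //; exact: ltW.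
(* A common point would have both [p] and [q] as gates. *)
have hk u v : 0 <= u <= r -> 0 <= v <= rho -> h u <> k v.
  move=> ur vr huv; apply: npq.
  apply: (@gate_uniq (h u)); first exact: gate_geodesic xp hg h0 hp ur.
  by rewrite huv; exact: gate_geodesic yq kgrho k0 kq vr.
have hit0 : (c @` `[0, l]) (h 0).
  by exists 0; rewrite ?h0//= in_itv/= lexx.
(* Starting [h] at its last point on [c], and then [k] at its last point on the remaining part of
   [c], leaves sides that meet only at vertices. *)
have [|u0 [u0r [s0 /=]]] := geodesic_last_hit (geodesic_image_closed cg) hg _ hit0.
  by lra.
rewrite in_itv/= => s0l hs0 nhC.
have cs0g : geodesic_on c s0 l by apply: geodesic_on_sub cg => //; lra.
have hit1 : (c @` `[s0, l]) (k 0).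
  by exists l; rewrite ?k0//= in_itv/= lexx; lra.
have [|v0 [v0r [s1 /=]]] :=
    geodesic_last_hit (geodesic_image_closed cs0g) kgrho _ hit1.
  by lra.
rewrite in_itv/= => s1l ks1 nkC.
apply: (nA s0 s0l).
apply: (triangle_in_piece (f := c) (a1 := s0) (b1 := s1) (g := k) (a2 := v0)
  (b2 := r') (h := fun t => h (- t)) (a3 := - r) (b3 := - u0) (s := rho) (t := r')).
- by apply: geodesic_on_sub cg; lra.
- by apply: geodesic_on_sub kg; lra.
- by apply: geodesic_on_opp; apply: geodesic_on_sub hg; lra.
- by lra.
- by lra.
- by lra.
- by [].
- by rewrite opprK kp hp.
- by rewrite opprK.
- move=> s v ss vv e.
  have vrho : v <= rho.
    have [//|lt] := leP v rho; case: (nA s); first by lra.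
    by rewrite e; apply: kA; lra.
  have vE : v = v0.
    have [vv0|v0v] := leP v v0; first by lra.
    case: (nkC v); first by lra.
    by exists s => //=; rewrite in_itv/=; lra.
  split=> //; apply: (geodesic_on_inj cg); [lra|lra|].
  by rewrite e vE ks1.
- move=> v u vv uu e.
  have [vrho|rhov] := leP v rho.
    by case: (hk (- u) v); [lra|lra|rewrite e].
  have uE : u = - r.
    have [ur|ru] := leP u (- r); first by lra.
    case: (gate_geodesic_disjoint (u := - u) xp hg h0); first by rewrite -/r; lra.
    by rewrite -e; apply: kA; lra.
  split=> //; apply: (geodesic_on_inj kg); [lra|lra|].
  by rewrite e uE opprK hp kp.
- move=> s u ss uu e.
  have uE : u = - u0.
    have [u0u|uu0] := leP (- u) u0; first by lra.
    case: (nhC (- u)); first by lra.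
    by exists s => //=; rewrite in_itv/=; lra.
  split=> //; apply: (geodesic_on_inj cg); [lra|lra|].
  by rewrite e uE opprK hs0.
- by lra.
- by lra.
- by rewrite kq kp; exact: nesym.
- by rewrite kq.
- by rewrite kp.
Qed.

(** One side consists of the points with gate [p]. By [gate_avoiding], a geodesic from there to a
    point with another gate must meet [A], and reaching [A] from that side costs a passage through
    [p]. *)
Lemma gate_separates x p a : ~ A x -> gate x p -> A a -> a <> p ->
  separates p x a.
Proof.
move=> nAx xp Aa ap; have [Ap _] := xp.
exists [set z | gate z p /\ z <> p]; split.
- move=> z b [zp nzp] nb.
  have [->|nbp] := pselect (b = p); first by rewrite mdistxx addr0.
  have [|q bq] := gate_ex b; first by exists p.
  have npq : p <> q by move=> pq; apply: nb; rewrite pq; split => //; rewrite -pq.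
  have [c [cg cz cb]] := geodesic_between z b.
  have [t tl At] : exists2 t, 0 <= t <= mdist z b & A (c t).
    apply: contrapT => nt; apply: npq.
    apply: (gate_avoiding cg (mdist_ge0 _ _)).
    + by move=> t tl At; apply: nt; exists t.
    + by rewrite cz.
    + by rewrite cb.
  have [t0 tb] := andP tl; have := zp.2 _ At.
  have := geodesic_onE cg (lexx _) t0 tb; have := geodesic_onE cg t0 tb (lexx _).
  rewrite cz cb; have := metric_triangle z p b.
  by have := metric_triangle p (c t) b; lra.
- by split => // xp'; apply: nAx; rewrite xp'.
- by move=> [[_ /(_ _ Aa)]]; rewrite mdistxx => e _; apply: ap;
    apply: mdist_positivity; have := mdist_ge0 a p; have := mdist_ge0 p a; lra.
- by split=> [px|]; [apply: nAx; rewrite -px|exact: nesym].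
Qed.

Lemma piece_separates x p q : ~ A x -> A p -> A q -> p <> q ->
  exists v y z, separates v y z.
Proof.
move=> nAx Ap Aq pq; have [|r xr] := gate_ex x; first by exists p.
have [pr|npr] := pselect (p = r).
  by exists r, x, q; apply: gate_separates => // qr; apply: pq; rewrite pr.
by exists r, x, p; exact: gate_separates.
Qed.

End Gate.

Lemma tree_graded_separates (P : set (set T)) : tree_graded P -> unbounded T ->
  ~ P setT -> exists v y z, separates v y z.
Proof.
move=> [_ gT PT T1 T2] uT nPT.
have loop c (l : R) : simple_loop c l -> 0 < l -> c 0 <> c (l / 2).
  move=> cs l0 e; have := cs 0 (l / 2); rewrite !in_itv/= lexx.
  by move=> /(_ l0 ltac:(lra) e); lra.
(* When all pieces are points there is no simple triangle, and any geodesic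
   segment can play the role of a piece. *)
have [[A [PA nA]]|nP] := pselect (exists A, P A /\ ~ is_subset1 A).
  have [clA gA] := PT A PA.
  have [x nAx] : exists x, ~ A x.
    apply: contrapT => nx; apply: nPT; suff <- : A = setT by [].
    by apply/seteqP; split => // x _; apply: contrapT => nAx; apply: nx; exists x.
  have [p [q [Ap Aq pq]]] : exists p q, [/\ A p, A q & p <> q].
    apply: contrapT => nex; apply: nA => p q Ap Aq.
    by apply: contrapT => pq; apply: nex; exists p, q.
  apply: (piece_separates gT clA gA _ nAx Ap Aq pq).
  move=> c a b l p' q' ct cs l0 Ap' Aq' pq' cp' cq'.
  have [B PB cB] := T2 _ _ _ _ ct cs l0.
  suff -> : A = B by [].
  apply: contrapT => nAB; apply: pq'; apply: (T1 _ _ PA PB nAB).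
    by split => //; exact: cB.
  by split => //; exact: cB.
have [x [y xy]] := uT 0.
have [c [l [l0 cg cx cy _]]] := @gT x y I I.
(* Two points farther apart than [l] cannot both lie on the segment, which is therefore a proper
   subset. *)
have [u [v uv]] := uT l.
have Ac : ~ ((c @` `[0, l]) u /\ (c @` `[0, l]) v).
  move=> [[s /= sl su] [t /= tl tv]]; move: uv; rewrite -su -tv cg//.
  by move: sl tl; rewrite !in_itv/= ltr_normr => sl tl /orP[]; lra.
have [z nAz] : exists z, ~ (c @` `[0, l]) z.
  by have /not_andP[nu|nv] := Ac; [exists u|exists v].
apply: (@piece_separates (c @` `[0, l]) gT (geodesic_image_closed cg) _ _ z x y) => //.
- move=> _ _ [s /= sl <-] [t /= tl <-]; move: sl tl; rewrite !in_itv/= => sl tl.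
  wlog st : s t sl tl / s <= t.
    move=> H; have [st|ts] := leP s t; first exact: H.
    have [k [m [m0 kg k0 km kc]]] := H _ _ tl sl (ltW ts).
    exists (fun r => k (m - r)), m; split; rewrite ?subr0 ?subrr//.
      move=> r r'; rewrite !in_itv/= => rm r'm; rewrite kg ?in_itv/=; [|lra|lra].
      by rewrite -normrN; congr (`|_|); lra.
    move=> _ [r /= + <-]; rewrite in_itv/= => rm; apply: kc; exists (m - r) => //=.
    by rewrite in_itv/=; lra.
  exists (fun r => c (s + r)), (t - s); split.
  + by lra.
  + move=> r r'; rewrite !in_itv/= => rm r'm; rewrite cg ?in_itv/=; [|lra|lra].
    by congr (`|_|); lra.
  + by rewrite addr0.
  + by congr c; lra.
  + move=> _ [r /= + <-]; rewrite in_itv/= => rm; exists (s + r) => //=.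
    by rewrite in_itv/=; lra.
- move=> k a b m p q kt ks m0 _ _ _ _ _; exfalso; apply: nP.
  have [B PB kB] := T2 _ _ _ _ kt ks m0; exists B; split => // B1.
  apply: (loop _ _ ks m0); apply: B1; apply: kB.
    by exists 0; rewrite //= in_itv/=; lra.
  by exists (m / 2); rewrite //= in_itv/=; lra.
- by exists 0; rewrite //= in_itv/= lexx.
- by exists l; rewrite //= in_itv/= lexx l0.
- by move=> xyE; move: xy; rewrite xyE mdistxx ltxx.
Qed.

End Gates.

(** * Diagonal selection along a non-principal ultrafilter *)

Section NonprincipalUltrafilter.
Context {w : set_system nat} {wU : UltraFilter w}.
Hypothesis hw : nonprincipal w.

Lemma nonprincipal_setC1 i : \forall n \near w, n <> i.
Proof.
have [wi|//] := in_ultra_setVsetC [set i] wU.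
exfalso; apply: (hw (i := i)); apply/seteqP; split => B.
  move=> wB; apply/principal_filterP.
  by have [_ [-> Bi]] := filter_ex (filterI wi wB).
by move=> /principal_filterP Bi; apply: filterS wi => _ ->.
Qed.

Lemma nonprincipal_ge N : \forall n \near w, (N <= n)%N.
Proof.
elim: N => [|N IH]; first exact: nearW.
by apply: filterS2 IH (nonprincipal_setC1 N) => n; rewrite leq_eqVlt => /orP[/eqP->|].
Qed.

(** [f n] is the largest [k <= n] with [Q k n]. The bound [n] makes the maximum exist, and
    non-principality makes each fixed [k] a candidate for almost all [n]. *)
Lemma ultrafilter_saturation (Q : nat -> nat -> Prop) :
  (forall k, \forall n \near w, Q k n) ->
  exists f : nat -> nat, forall k, \forall n \near w, (k <= f n)%N /\ Q (f n) n.
Proof.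
move=> wQ.
have ex n : exists m, Q 0%N n -> Q m n /\
    forall k, (k <= n)%N -> Q k n -> (k <= m)%N.
  have [Q0|nQ0] := pselect (Q 0%N n); last by exists 0%N.
  pose P k := `[< Q k n >] && (k <= n)%N.
  have exP : exists k, P k by exists 0%N; apply/andP; split => //; apply/asboolP.
  have ubP k : P k -> (k <= n)%N by move=> /andP[].
  have [m /andP[/asboolP Qm _] mmax] := ex_maxnP exP ubP.
  exists m => _; split => // k kn Qk; apply: mmax; apply/andP; split => //.
  exact/asboolP.
have [f hf] := choice ex; exists f => k.
apply: filterS3 (wQ 0%N) (wQ k) (nonprincipal_ge k) => n Q0 Qk kn.
by have [Qf max] := hf n Q0; split => //; apply: max.
Qed.

End NonprincipalUltrafilter.

Lemma real_cvg_unique {R : realType} {I : Type} {F : set_system I}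
    {FF : ProperFilter F} (f : I -> R) (a b : R) :
  f @ F --> a -> f @ F --> b -> a = b.
Proof.
move=> fa fb; apply: (@cvg_unique _ _ (f @ F)) fa fb.
exact: norm_hausdorff.
Qed.

(** * Sequences representing points of the ultralimit *)

Section UltralimitPoints.
Context {R : realType} {w : set_system nat} {wU : UltraFilter w}.
Variables (X : nat -> metricType R) (o : forall n, X n).
Local Notation L := (ultralimit w X o).
Implicit Types (u v : L) (x y : forall n, X n).

(** [x] carries no proof of admissibility and is compared with the chosen representative, so later
    arguments can use bare sequences without the quotient. *)
Definition represents x u :=
  mdist (x n) (sval (repr u) n) @[n --> w] --> (0 : R).

Lemma represents_repr u : represents (sval (repr u)) u.
Proof.
rewrite /represents; under eq_fun do rewrite mdistxx.
exact: cvg_cst.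
Qed.

Lemma represents_dist x y u v : represents x u -> represents y v ->
  mdist (x n) (y n) @[n --> w] --> mdist u v.
Proof.
move=> xu yv; have uv := @seq_dist_cvg _ _ wU _ _ (repr u) (repr v).
have /(_ _) xyv := cvgD xu yv; rewrite addr0 in xyv.
have /(_ _) lo := cvgB uv xyv; have /(_ _) hi := cvgD uv xyv.
rewrite subr0 in lo; rewrite addr0 in hi.
apply: (squeeze_cvgr _ lo hi); apply: nearW => n; rewrite !fctE.
set a := sval (repr u) n; set b := sval (repr v) n.
have := metric_triangle a (x n) b; have := metric_triangle (x n) (y n) b.
have := metric_triangle (x n) a (y n); have := metric_triangle a b (y n).
by rewrite (metric_sym a (x n)) (metric_sym b (y n)); lra.
Qed.

Lemma represents_uniq x u v : represents x u -> represents x v -> u = v.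
Proof.
move=> xu xv; apply: mdist_positivity.
have := represents_dist xu xv; under eq_fun do rewrite mdistxx.
by move/real_cvg_unique; apply; exact: cvg_cst.
Qed.

Lemma represents_near x y u : represents x u ->
  mdist (x n) (y n) @[n --> w] --> (0 : R) -> represents y u.
Proof.
move=> xu xy; have /(_ _) := cvgD xy xu; rewrite addr0.
apply: squeeze_cvgr (cvg_cst 0); apply: nearW => n; rewrite !fctE.
by rewrite mdist_ge0/= (metric_sym (x n) (y n)) metric_triangle.
Qed.

Lemma represents_ex x u (M : R) :
  (\forall n \near w, mdist (x n) (sval (repr u) n) <= M) ->
  exists v, represents x v.
Proof.
move=> xM.
have ax : admissible w o x.
  apply/asboolP; have [N uN] := ultra_cvg_bounded (asboolW (svalP (repr u))).
  apply: (@ultra_bounded_cvg _ _ _ _ (M + N)).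
  apply: filterS2 xM uN => n xM uN; rewrite mdist_ge0/=.
  exact: le_trans (metric_triangle _ (sval (repr u) n) _) (lerD xM uN).
pose z : admissible_seq w o := exist _ x ax.
exists (\pi_L%qT z); set v := \pi_L%qT z.
rewrite /represents; have <- : seq_dist z (repr v) = 0.
  have : (z = repr v %[mod L])%qT by rewrite reprK.
  by move/eqmodP/eqP.
exact: (@seq_dist_cvg _ _ _ _ _ z (repr v)).
Qed.

End UltralimitPoints.

(** * Completeness, geodesics and separation in the ultralimit *)

Section UltralimitGeometry.
Context {R : realType} {w : set_system nat} {wU : UltraFilter w}.
Variables (X : nat -> metricType R) (o : forall n, X n).
Local Notation L := (ultralimit w X o).
Implicit Types (u v : L) (x y : forall n, X n).

(* Diagonal argument: z n follows the term of index f n, where f n tends to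
   infinity along w slowly enough for the Cauchy estimates to hold up to f n. *)
Lemma ultralimit_complete : nonprincipal w -> complete_space L.
Proof.
move=> hw F FF /cauchyP cF.
pose e k : R := k.+1%:R^-1.
have e0 k : 0 < e k by rewrite invr_gt0.
have [p Fp] := choice (fun k => cF _ (e0 k)).
have pp i j : mdist (p i) (p j) < e i + e j.
  have [z []] := filter_ex (filterI (Fp i) (Fp j)).
  rewrite !ballEmdist/= => zi zj; apply: le_lt_trans (metric_triangle _ z _) _.
  by rewrite ltrD// metric_sym.
pose r k n : X n := sval (repr (p k)) n.
pose Q k n := forall i : 'I_k.+1, mdist (r i n) (r k n) < e i + e k.
have [f hf] : exists f : nat -> nat, forall k, \forall n \near w,
    (k <= f n)%N /\ Q (f n) n.
  apply: ultrafilter_saturation hw _ _ => k; apply: filter_forall => i.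
  have h : mdist (r i n) (r k n) @[n --> w] --> mdist (p i) (p k).
    exact: represents_dist (represents_repr _) (represents_repr _).
  exact: (cvgr_lt _ h _ (pp i k)).
pose z n := r (f n) n.
have zr k : \forall n \near w, mdist (z n) (r k n) <= 2 * e k.
  apply: filterS (hf k) => n [kf Qf]; rewrite metric_sym.
  have kf' : (k < (f n).+1)%N by [].
  apply: le_trans (ltW (Qf (Ordinal kf'))) _ => /=.
  have : e (f n) <= e k by rewrite lef_pV2 ?posrE// ler_nat.
  lra.
have [v zv] := represents_ex (zr 0%N).
exists v; apply/metricType_numDomainType.fcvgrPdist_lt => eps eps0.
(* The factor 3 is 2 for the distance from [v] to [p k] plus 1 for the ball around [p k]. *)
have [k ek] : exists k, 3 * e k < eps.
  exists (Num.truncn (3 / eps)); rewrite ltr_pdivrMr// mulrC -ltr_pdivrMr//.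
  exact: truncnS_gt.
apply: filterS (Fp k) => y; rewrite ballEmdist/= => yk.
have vk : mdist v (p k) <= 2 * e k.
  exact: (cvgr_to_le (represents_dist zv (represents_repr (p k))) (zr k)).
by apply: le_lt_trans (metric_triangle _ (p k) _) _; lra.
Qed.

Lemma ultralimit_geodesic : (forall n, geodesic_space (X n)) -> geodesic_space L.
Proof.
move=> gX u v _ _; pose a n := sval (repr u) n; pose b n := sval (repr v) n.
have gn n : {c : R -> X n | exists l, [/\ 0 <= l, geodesic_on c 0 l,
    c 0 = a n & c l = b n]}.
  by apply: cid; have [c [l [? ? ? ? _]]] := gX n (a n) (b n) I I; exists c, l.
pose c n := sval (gn n); pose l n := mdist (a n) (b n).
have cP n : [/\ geodesic_on (c n) 0 (l n), c n 0 = a n & c n (l n) = b n].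
  have [k [k0 ck ca cb]] := svalP (gn n).
  suff -> : l n = k by [].
  by have := geodesic_onE ck (lexx _) k0 (lexx _); rewrite ca cb subr0.
have l0 n : 0 <= l n by exact: mdist_ge0.
have lD : l n @[n --> w] --> mdist u v.
  exact: represents_dist (represents_repr _) (represents_repr _).
pose D := mdist u v; have D0 : 0 <= D by exact: mdist_ge0.
(* Times are truncated at [l n], which may be smaller than the limit length [D]; the truncation
   disappears in the limit for times up to [D]. *)
have cD n s t : 0 <= s -> 0 <= t ->
    mdist (c n (Num.min s (l n))) (c n (Num.min t (l n))) =
    `|Num.min s (l n) - Num.min t (l n)|.
  move=> s0 t0; have [cg _ _] := cP n.
  by apply: cg; rewrite in_itv/= le_min ge_min lexx orbT l0 ?s0 ?t0.
have minD s : Num.min s (l n) @[n --> w] --> Num.min s D.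
  apply/cvgrPdist_lt => e e0.
  apply: (filterS _ ((cvgrPdist_lt _ _).1 lD e e0)) => n; rewrite !ltr_norml -/D.
  by case: (leP s (l n)); case: (leP s D); lra.
have ex t : exists z : L, 0 <= t -> represents (fun n => c n (Num.min t (l n))) z.
  have [t0|//] := pselect (0 <= t); last by exists u.
  have [|z hz] := @represents_ex _ _ _ _ _ (fun n => c n (Num.min t (l n))) u t.
    apply: nearW => n; have [_ c0 _] := cP n.
    have <- : c n (Num.min 0 (l n)) = sval (repr u) n by rewrite min_l.
    by rewrite cD// (min_l (l0 n)) subr0 ger0_norm ?le_min ?t0 ?l0// ge_min lexx.
  by exists z.
have [g hg] := choice ex; exists g, D; split => //.
- move=> s t; rewrite !in_itv/= => /andP[s0 sD] /andP[t0 tD].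
  have := represents_dist (hg _ s0) (hg _ t0); under eq_fun do rewrite cD//.
  have : `|Num.min s (l n) - Num.min t (l n)| @[n --> w] -->
      `|Num.min s D - Num.min t D| by apply: cvg_norm; exact: cvgB.
  by rewrite !min_l// => h1 h2; exact: real_cvg_unique h2 h1.
- apply: (represents_uniq (hg _ (lexx 0))).
  apply: represents_near (represents_repr u) _.
  under eq_fun => n.
    have [_ c0 _] := cP n; rewrite (min_l (l0 n)) c0 mdistxx.
    over.
  exact: cvg_cst.
- apply: (represents_uniq (hg _ D0)).
  apply: represents_near (represents_repr v) _.
  under eq_fun => n.
    have [_ _ cl] := cP n.
    have -> : sval (repr v) n = c n (Num.min (l n) (l n)) by rewrite minxx.
    rewrite cD// minxx.
    over.
  have : `|l n - Num.min D (l n)| @[n --> w] --> `|D - Num.min D D|.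
    by apply: cvg_norm; exact: cvgB.
  by rewrite minxx subrr normr0.
Qed.

(** The cut equalities hold for almost all [n] and pass to the limit. If a point is not a limit of
    points of [U n], its representative is in the complement for almost all [n], by the ultrafilter
    dichotomy. *)
Lemma ultralimit_separates (U : forall n, set (X n)) x y z (u v t : L) :
  represents x u -> represents y v -> represents z t ->
  (forall n, cut_set (z n) (U n)) ->
  (\forall n \near w, U n (x n)) -> (\forall n \near w, ~ U n (y n)) ->
  t <> u -> t <> v -> separates t u v.
Proof.
move=> xu yv zt zU Ux Uy tu tv.
(* The point t is excluded since it may be a limit of points of both sides. *)
exists [set s | s <> t /\
  exists2 r, represents r s & \forall n \near w, U n (r n)].
have key r s r' s' : represents r s -> represents r' s' ->
    (\forall n \near w, U n (r n)) -> (\forall n \near w, ~ U n (r' n)) ->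
    mdist s s' = mdist s t + mdist t s'.
  move=> rs rs' Ur Ur'.
  apply: (real_cvg_unique (represents_dist rs rs')).
  apply: cvg_trans (cvgD (represents_dist rs zt) (represents_dist zt rs')).
  by apply: near_eq_cvg; apply: filterS2 Ur Ur' => n Ur Ur'; rewrite (zU n _ _ Ur Ur').
split => //.
- move=> a b [_ [r ra Ur]] nUb.
  have [->|bt] := pselect (b = t); first by rewrite mdistxx addr0.
  apply: key ra (represents_repr b) Ur _.
  have [Ub|//] := in_ultra_setVsetC [set n | U n (sval (repr b) n)] wU.
  by exfalso; apply: nUb; split => //; exists (sval (repr b)) => //;
    exact: represents_repr.
- by split; [exact/nesym|exists x].
- move=> [_ [r rv Ur]]; apply: tv.
  have := key _ _ _ _ rv yv Ur Uy; rewrite mdistxx => e.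
  by apply: mdist_positivity; have := mdist_ge0 t v; have := mdist_ge0 v t; lra.
Qed.

End UltralimitGeometry.

(** * Discrete walks through cut points *)

Section CutChains.
Context {R : realType} (T : metricType R).
Implicit Types (v x y : T) (U : set T) (c : R -> T).

Definition cut_chain (e : R) (p : nat -> T) :=
  (forall i m, mdist (p i) (p (i + m)%N) = m%:R * e) /\
  forall k, exists U, [/\ cut_set (p k) U,
    forall i, (i < k)%N -> U (p i) & forall j, (k < j)%N -> ~ U (p j)].

Lemma cut_set_at_distance v x U (e : R) : geodesic_space T -> cut_set v U ->
  U x -> 0 < e <= mdist v x -> exists2 y, U y & mdist v y = e.
Proof.
move=> gT vU Ux /andP[e0 ex]; have [c [l [l0 cg c0 cl _]]] := gT v x I I.
have dl := geodesic_onE cg (lexx _) l0 (lexx _); rewrite c0 cl subr0 in dl.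
rewrite dl in ex.
have de := geodesic_onE cg (lexx _) (ltW e0) ex; rewrite c0 subr0 in de.
have del := geodesic_onE cg (ltW e0) ex (lexx _); rewrite cl in del.
exists (c e) => //; apply: cut_set_near vU _ Ux.
by rewrite metric_sym del metric_sym dl; lra.
Qed.

(** An isometry carries the separation at [v0] to [v]. Both sides then reach every distance up to
    [d] from [v], and [y] is taken on the side that does not contain [u]. *)
Lemma homogeneous_cut v0 x0 y0 : geodesic_space T -> homogeneous T ->
  separates v0 x0 y0 -> exists2 d : R, 0 < d &
  forall e, 0 < e <= d -> forall u v, exists y U,
    [/\ cut_set v U, U u, ~ U y & mdist v y = e].
Proof.
move=> gT hT [U0 [vU Ux nUy [vx vy]]].
exists (Num.min (mdist v0 x0) (mdist v0 y0)).
  by rewrite lt_min !mdist_gt0P.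
move=> e; rewrite le_min => /andP[e0 /andP[ex ey]] u v.
have [f [[g fK gK] fd] fv] := hT v0 v.
have gd a b : mdist (g a) (g b) = mdist a b by rewrite -fd !gK.
pose W : set T := [set a | U0 (g a)].
have gv : g v = v0 by rewrite -fv fK.
have vW : cut_set v W.
  by move=> a b Wa nWb; rewrite -(gd a b) -(gd a v) -(gd v b) gv; exact: vU.
have [x Wx dx] : exists2 x, W x & mdist v x = e.
  apply: (cut_set_at_distance (x := f x0) gT vW); first by rewrite /W/= fK.
  by rewrite -gd gv fK e0.
have [y nWy dy] : exists2 y, (~` W) y & mdist v y = e.
  apply: (cut_set_at_distance (x := f y0) gT (cut_setC vW)).
    by rewrite /W/= fK.
  by rewrite -gd gv fK e0.
have [Wu|nWu] := pselect (W u); first by exists y, W.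
by exists x, (~` W); split => //; exact: cut_setC.
Qed.

Lemma cut_chain_ex (e : R) x : 0 < e ->
  (forall u v, exists y U, [/\ cut_set v U, U u, ~ U y & mdist v y = e]) ->
  exists2 p, p 0%N = x & cut_chain e p.
Proof.
move=> e0 cut.
have [F hF] := choice (fun q : T * T => cut q.1 q.2).
(* The state is the pair of previous and current points; the walk starts with both equal to [x]. *)
pose s k := iter k (fun q : T * T => (q.2, F q)) (x, x).
pose p k := (s k).2.
have pS k : p k.+1 = F (s k) by [].
have d1 k : mdist (p k) (p k.+1) = e by have [U []] := hF (s k).
(* An earlier point on the far side of [p k] would give [m * e = e + (m + 1) * e]. *)
have past k U i m : k = (i + m).+1 -> cut_set (p k) U -> U (p (i + m)%N) ->
    mdist (p i) (p (i + m)%N) = m%:R * e ->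
    mdist (p i) (p k) = m.+1%:R * e -> U (p i).
  move=> -> kU Up dm dm1; apply: contrapT => nUp.
  have := kU _ _ Up nUp; rewrite d1 (metric_sym _ (p i)) (metric_sym _ (p i)).
  by rewrite dm dm1 -natr1 mulrDl mul1r; lra.
(* Crossing [p (i + m).+1] adds [e] to the distance from [p i]. Locating [p i] by [past] takes the
   distances for both [m] and [m.+1], hence the paired induction. *)
have dm m : (forall i, mdist (p i) (p (i + m)%N) = m%:R * e) /\
    (forall i, mdist (p i) (p (i + m.+1)%N) = m.+1%:R * e).
  elim: m => [|m [IH IH1]].
    by split=> i; rewrite ?addn1 ?d1 ?mul1r// addn0 mdistxx mul0r.
  split=> // i.
  have [U [kU Us nUF _]] := hF (s (i + m).+1).
  have Up : U (p i).
    by apply: (past _ _ _ _ erefl kU); rewrite ?IH// -addnS IH1.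
  rewrite [in LHS]addnS [in LHS]addnS (kU _ _ Up nUF) -/(p _) -addnS IH1.
  by rewrite -[in RHS]natr1 mulrDl mul1r addnS; congr (_ + _); exact: d1.
exists p => //; split => [i m|k]; first by have [] := dm m.
have [U [kU Us nUF _]] := hF (s k); exists U; split => //.
- move=> i ik; have kE : k = (i + (k - i.+1)).+1 by rewrite -addSn subnKC.
  apply: (past _ _ _ _ kE kU).
  + by move: Us; rewrite kE /= -kE.
  + by have [] := dm (k - i.+1)%N.
  + by rewrite {1}kE -addnS; have [] := dm (k - i.+1)%N.
(* A later point on the near side would be separated by [p k] from [p k.+1], hence farther from
   [p k.+1] than from [p k]. *)
- move=> j kj Uj; have jE : j = (k.+1 + (j - k.+1))%N by rewrite subnKC.
  have := kU _ _ Uj nUF; rewrite -/(p k) -(pS k) d1.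
  rewrite (metric_sym _ (p k.+1)) (metric_sym _ (p k)).
  have [d0 _] := dm (j - k.+1)%N; have [_ d2] := dm (j - k.+1)%N.
  have := d0 k.+1; rewrite -jE => ->.
  have := d2 k; rewrite addnS -addSn -jE => ->.
  by rewrite -natr1 mulrDl mul1r; lra.
Qed.

End CutChains.

(** * The limit of the walks is a ray of cut points *)

Section UltralimitRay.
Context {R : realType} {w : set_system nat} {wU : UltraFilter w}.
Variables (X : nat -> metricType R) (o : forall n, X n).
Local Notation L := (ultralimit w X o).

Lemma truncn_div_bounds (e s : R) : 0 < e -> 0 <= s ->
  (Num.truncn (s / e))%:R * e <= s < (Num.truncn (s / e))%:R * e + e.
Proof.
move=> e0 s0; have se : 0 <= s / e by rewrite divr_ge0// ltW.
have /andP[lo hi] := truncn_itv se.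
by rewrite -ler_pdivlMr// lo/= -[X in _ < _ + X]mul1r -mulrDl natr1 -ltr_pdivrMr.
Qed.

Lemma cut_chain_dist (T : metricType R) (e : R) (p : nat -> T) i j :
  cut_chain e p -> (i <= j)%N -> mdist (p i) (p j) = j%:R * e - i%:R * e.
Proof.
by move=> [pd _] ij; rewrite -[in LHS](subnKC ij) pd natrB// mulrBl.
Qed.

Lemma ultralimit_cut_ray (e : nat -> R) (p : forall n, nat -> X n) (x : L) :
  (forall n, 0 < e n) -> e n @[n --> w] --> (0 : R) ->
  (forall n, cut_chain (e n) (p n)) ->
  (forall n, p n 0%N = sval (repr x) n) ->
  exists g : R -> L, [/\ g 0 = x,
    forall s t, 0 <= s <= t -> mdist (g s) (g t) = t - s &
    forall s u t, 0 <= s -> s < u -> u < t -> separates (g u) (g s) (g t)].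
Proof.
move=> e0 elim0 pc px.
(* The number of steps of length [e n] that fit in time [t]; the walk then lags behind [t] by less
   than [e n]. *)
pose k t n := Num.truncn (t / e n).
have kB t n : 0 <= t -> (k t n)%:R * e n <= t < (k t n)%:R * e n + e n.
  by move=> t0; exact: truncn_div_bounds.
have kle s t n : s <= t -> (k s n <= k t n)%N.
  by move=> st; apply: le_truncn; rewrite ler_pM2r// invr_gt0.
pose q t n : X n := p n (k t n).
have qd s t n : s <= t -> mdist (q s n) (q t n) = (k t n)%:R * e n - (k s n)%:R * e n.
  by move=> st; exact: cut_chain_dist (kle _ _ _ st).
have k0 n : k 0 n = 0%N by rewrite /k mul0r truncn0.
have ex t : exists z : L, 0 <= t -> represents (q t) z.
  have [t0|//] := pselect (0 <= t); last by exists x.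
  have [|z hz] := @represents_ex _ _ _ _ _ (q t) x t; last by exists z.
  apply: nearW => n; rewrite -px -(k0 n) metric_sym -/(q 0 n) qd// k0.
  by have := kB t n t0; lra.
have [g hg] := choice ex.
have gd s t : 0 <= s <= t -> mdist (g s) (g t) = t - s.
  move=> /andP[s0 st]; have t0 := le_trans s0 st.
  apply: (real_cvg_unique (represents_dist (hg _ s0) (hg _ t0))).
  have lo : (t - s) - e n @[n --> w] --> t - s.
    by rewrite -[X in _ --> X]subr0; apply: cvgB => //; exact: cvg_cst.
  have hi : (t - s) + e n @[n --> w] --> t - s.
    by rewrite -[X in _ --> X]addr0; apply: cvgD => //; exact: cvg_cst.
  apply: (squeeze_cvgr _ lo hi); apply: nearW => n.
  by rewrite qd//; have := kB s n s0; have := kB t n t0; lra.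
exists g; split => //.
  apply: represents_uniq (hg _ (lexx 0)) _.
  have -> : q 0 = sval (repr x) by apply: functional_extensionality_dep => n; rewrite /q k0 px.
  exact: represents_repr.
move=> s u t s0 su ut; have u0 := le_trans s0 (ltW su); have t0 := le_trans u0 (ltW ut).
(* Cuts of the chain say nothing about their own index, so strict inequalities are needed; they hold
   once [e n < b - a]. *)
have lt a b : 0 <= a -> a < b -> \forall n \near w, (k a n < k b n)%N.
  move=> a0 ab; have ba : 0 < b - a by rewrite subr_gt0.
  apply: filterS (cvgr_lt _ elim0 _ ba) => n eba.
  have b0 := ltW (le_lt_trans a0 ab).
  rewrite ltnNge; apply/negP => kba.
  have kba' : (k b n)%:R * e n <= (k a n)%:R * e n.
    by rewrite ler_pM2r// ler_nat.
  by have := kB a n a0; have := kB b n b0; lra.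
have neq a b : 0 <= a -> a < b -> g a <> g b.
  move=> a0 ab gab; have := gd a b; rewrite gab mdistxx a0 ltW// => /(_ isT).
  by lra.
have V n : {U | [/\ cut_set (q u n) U, forall i, (i < k u n)%N -> U (p n i) &
    forall j, (k u n < j)%N -> ~ U (p n j)]}.
  by apply: cid; have [_] := pc n; exact.
apply: (@ultralimit_separates _ _ _ _ _ (fun n => sval (V n)) (q s) (q t) (q u)).
- exact: hg.
- exact: hg.
- exact: hg.
- by move=> n; have [] := svalP (V n).
- by apply: filterS (lt _ _ s0 su) => n; have [_ h _] := svalP (V n); exact: h.
- by apply: filterS (lt _ _ u0 ut) => n; have [_ _ h] := svalP (V n); exact: h.
- exact/nesym/neq.
- exact: neq.
Qed.

End UltralimitRay.

(** The arc is [g] on [[0, 1]]. Two of its points in one block would be inseparable, yet the point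
    of [g] at the midpoint time separates them. *)
Lemma transversal_tree_ray {R : realType} (T : metricType R) (x : T) (g : R -> T) :
  g 0 = x -> (forall s t, 0 <= s <= t -> mdist (g s) (g t) = t - s) ->
  (forall s u t, 0 <= s -> s < u -> u < t -> separates (g u) (g s) (g t)) ->
  nontrivial_transversal_tree (@blocks R T) x.
Proof.
move=> g0 gd gs tx.
have gE s t : 0 <= s -> 0 <= t -> mdist (g s) (g t) = `|s - t|.
  move=> s0 t0; case: (leP s t) => st.
    by rewrite gd ?s0// distrC ger0_norm// subr_ge0.
  by rewrite metric_sym gd ?t0 ?ltW// gtr0_norm ?subr_gt0.
have inj s t : 0 <= s -> 0 <= t -> g s = g t -> s = t.
  move=> s0 t0 gst; apply/eqP; rewrite -subr_eq0 -normr_eq0 -gE// gst.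
  by rewrite mdistxx.
have : transversal_tree (@blocks R T) x (g 1).
  right; exists g; last by exists 1 => //=; rewrite in_itv/= ler01 lexx.
  split; first split => //.
  - apply/subspace_continuousP => r /=; rewrite in_itv/= => /andP[r0 _].
    apply/metricType_numDomainType.fcvgrPdist_lt => e e0.
    apply: filterS (nbhsx_ballx r e e0) => s /= rs.
    by rewrite in_itv/= => /andP[s0 _]; rewrite gE.
  - move=> s t; rewrite !in_itv/= => /andP[s0 _] /andP[t0 _]; exact: inj.
  - move=> _ [a [b [nab ab ->]]].
    suff H s t : 0 <= s -> s < t -> block a b (g s) -> block a b (g t) -> False.
      move=> _ _ [[s /= + <-] bs] [[t /= + <-] bt]; rewrite !in_itv/=.
      move=> /andP[s0 _] /andP[t0 _].
      by case: (ltgtP s t) => [st|ts|->//]; exfalso; [exact: H bs bt|exact: H bt bs].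
    move=> s0 st bs bt; apply: (block_inseparable nab bs bt (v := g ((s + t) / 2))).
    by apply: gs => //; lra.
rewrite tx => /= g1; have := inj 1 0 ler01 (lexx _); rewrite g0 => /(_ g1).
by lra.
Qed.
Theorem proposition3p20 (R : realType) (X : nat -> metricType R)
    (P : forall n, set (set (X n))) (o : forall n, X n)
    (w : set_system nat) (wU : UltraFilter w) :
  nonprincipal w ->
  (forall n, homogeneous (X n)) ->
  (forall n, unbounded (X n)) ->
  (forall n, tree_graded (P n)) ->
  (forall n, ~ P n setT) ->
  exists Q : set (set (ultralimit w X o)),
    tree_graded Q /\ forall x, nontrivial_transversal_tree Q x.
Proof.
move=> hw hX uX tX nP; have gX n : geodesic_space (X n) by have [] := tX n.
exists (@blocks _ _); split.
  apply: blocks_tree_graded; first exact: ultralimit_complete.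
  exact: ultralimit_geodesic.
move=> x.
have chain n : {ep : R * (nat -> X n) | [/\ 0 < ep.1 <= n.+1%:R^-1,
    cut_chain ep.1 ep.2 & ep.2 0%N = sval (repr x) n]}.
  apply: cid.
  have [v [y [z vyz]]] := tree_graded_separates (tX n) (@uX n) (nP n).
  have [d d0 hd] := homogeneous_cut (gX n) (@hX n) vyz.
  (* The bound [d] makes steps of length [e] possible in [X n]; the bound [n.+1%:R^-1] makes the
     lengths tend to 0 along [w]. *)
  pose e := Num.min d n.+1%:R^-1.
  have e0 : 0 < e by rewrite lt_min d0 invr_gt0/= ltr0n.
  have [|p p0 pe] := cut_chain_ex (sval (repr x) n) e0.
    by apply: hd; rewrite e0 ge_min lexx.
  by exists (e, p); split => //=; rewrite e0 ge_min lexx orbT.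
have elim0 : (sval (chain n)).1 @[n --> w] --> (0 : R).
  apply/cvgrPdist_lt => e e0.
  apply: filterS (nonprincipal_ge hw (Num.truncn e^-1)) => n en.
  have [/andP[c0 cn] _ _] := svalP (chain n).
  rewrite sub0r normrN gtr0_norm//; apply: le_lt_trans cn _.
  rewrite -[ltRHS]invrK ltf_pV2 ?posrE ?invr_gt0//.
  by apply: lt_le_trans (truncnS_gt _) _; rewrite ler_nat.
have [|||g [g0 gd gs]] := @ultralimit_cut_ray _ _ _ _ _ _
    (fun n => (sval (chain n)).2) x _ elim0.
- by move=> n; have [/andP[]] := svalP (chain n).
- by move=> n; have [] := svalP (chain n).
- by move=> n; have [] := svalP (chain n).
exact: transversal_tree_ray g0 gd gs.
Qed.
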